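(* Let $G$ be a graph. Then $G$ is a Cayley graph of a left-cancellative monoid (that is, $G=\mathcal{C}\langle M,Q\rangle$ for some left-cancellative monoid $M$, some subset $Q\subseteq M$ generating $M$ as a monoid, and some injective labeling $\langle\,\rangle:Q\to A$) if and only if $G$ is rooted, simple, deterministic and arc-symmetric.
   Context: A graph (over a label set $A$) is a non-empty set $G\subseteq V\times A\times V$ of labeled edges; $(s,a,t)\in G$ is written $s\xrightarrow{a}_G t$, and $s\to_G t$ means $s\xrightarrow{a}_G t$ for some $a$. $V_G$ is the set of vertices that are source or target of some edge, $A_G$ the set of labels of edges; paths $s\xrightarrow{u}_G t$ with $u\in A_G^*$ are defined as usual. For a magma $(M,\cdot)$, a subset $Q\subseteq M$ and an injective map $\langle\,\rangle:Q\to A$, the generalized Cayley graph is $\mathcal{C}\langle M,Q\rangle=\{(p,\langle q\rangle,p\cdot q): p\in M,\ q\in Q\}$. A magma is left-cancellative if $r\cdot p=r\cdot q$ implies $p=q$. $Q$ generates the monoid $M$ if every element is a finite (possibly empty) product of elements of $Q$. $G$ is simple if there are no two edges with the same source and target; deterministic if $r\xrightarrow{a}s$ and $r\xrightarrow{a}t$ imply $s=t$; rooted if there is a vertex $r$ from which every vertex of $V_G$ is reachable by a directed path. For a vertex $s$, $G_{\downarrow s}$ is the subgraph of $G$ induced by the vertices reachable from $s$. $G$ is arc-symmetric if for all $s,t\in V_G$ there is a graph isomorphism (label-preserving bijection on vertices preserving edges in both directions) from $G_{\downarrow s}$ to $G_{\downarrow t}$ mapping $s$ to $t$. *)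

(* Defs.v *)
From HB Require Import structures.
From mathcomp Require Import all_boot.
From mathcomp Require Import boolp classical_sets functions.

Set Implicit Arguments.
Unset Strict Implicit.
Unset Printing Implicit Defensive.

Local Open Scope classical_set_scope.

(* A graph is given by its set of labelled edges (source, label, target); its
   vertices are the endpoints of its edges, not all of [V]. *)
Definition edges (V A : Type) := set (V * A * V).

Section Graphs.
Variables V A : Type.
Implicit Types (G H K : edges V A) (s t : V).

Definition is_graph G := G !=set0.

Definition vertices G : set V :=
  [set s | exists a t, G (s, a, t) \/ G (t, a, s)].

Definition simple G := forall s t a b, G (s, a, t) -> G (s, b, t) -> a = b.

Definition deterministic G :=
  forall r s t a, G (r, a, s) -> G (r, a, t) -> s = t.

Fixpoint path_in G s (u : seq A) t : Prop :=
  if u is a :: u' then exists2 r, G (s, a, r) & path_in G r u' t else s = t.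

Definition reachable G s : set V := [set t | exists u, path_in G s u t].

Definition rooted G := exists2 r, vertices G r & vertices G `<=` reachable G r.

Definition induced G (P : set V) : edges V A :=
  [set e | G e /\ P e.1.1 /\ P e.2].

Definition down G s : edges V A := induced G (reachable G s).

(* Only the restriction of [f] to [vertices H] matters. *)
Definition graph_iso H K (f : V -> V) :=
  set_bij (vertices H) (vertices K) f /\
  forall s a t, vertices H s -> vertices H t ->
    H (s, a, t) <-> K (f s, a, f t).

(* If [s] and [t] are sinks, [down G s] and [down G t] have no edge, hence no
   vertex, and the condition holds vacuously. This is harmless for nonempty [G]:
   the source of an edge is not a sink, and there is no isomorphism between its
   [down] and an empty graph, so an arc-symmetric nonempty graph has no sink. *)
Definition arc_symmetric G :=
  forall s t, vertices G s -> vertices G t ->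
    exists2 f, graph_iso (down G s) (down G t) f & f s = t.

End Graphs.

Section Cayley.
Local Open Scope group_scope.

Definition left_cancellative (M : magmaType) :=
  forall r p q : M, r * p = r * q -> p = q.

Definition generates (M : monoidType) (Q : set M) :=
  forall p : M, exists s : seq Q, p = \prod_(q <- s) val q.

Definition cayley (A : Type) (M : magmaType) (Q : set M) (lab : Q -> A) :
    edges M A :=
  [set (pq.1, lab pq.2, pq.1 * val pq.2) | pq in [set: M * Q]].

End Cayley.

(* G = C<M,Q> is an equality of sets of edges on [V], not an isomorphism, so the
   carrier of M is a subset [X] of [V]; [mX] is a monoid structure on [X], and
   [val] is the inclusion of [X] in [V]. *)
Definition is_left_cancellative_monoid_cayley (V A : Type) (G : edges V A) :=
  exists (X : set V) (mX : Monoid X),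
    let M : monoidType := Monoid.Pack mX in
    left_cancellative M /\
    exists (Q : set M) (lab : Q -> A),
      [/\ generates Q, injective lab &
        G = [set (val (e.1.1 : X), e.1.2, val (e.2 : X)) | e in cayley lab]].

(* Main.v *)
(* Left translations of a left-cancellative monoid are injective, so s x |-> t x
   is an isomorphism between the parts of the Cayley graph reachable from s and
   from t.  Conversely, let r be a root of an arc-symmetric graph.  For each
   vertex s there is an injective map f_s sending r to s and every path from r
   labelled by u to a path from s labelled by u; by determinism f_s is unique.
   The product s x := f_s x, that is, the endpoint of the path from s with the
   label of any path from r to x, turns the vertices into a left-cancellative
   monoid with unit r, generated by the successors of r. *)
Require Import Defs.
From HB Require Import structures.
From mathcomp Require Import all_boot.
From mathcomp Require Import boolp classical_sets.

Set Implicit Arguments.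
Unset Strict Implicit.
Unset Printing Implicit Defensive.

Local Open Scope classical_set_scope.

(** * Paths, reachability and determinism *)

Section Paths.
Variables (V A : Type) (G : edges V A).
Implicit Types (r s t x y : V) (a : A) (u v : seq A).

Lemma path_in_cat s u v t :
  path_in G s (u ++ v) t <-> exists2 r, path_in G s u r & path_in G r v t.
Proof.
elim: u s => [|a u IH] s /=; first by split=> [h|[r -> //]]; exists s.
split=> [[r e /IH[x ux xv]]|[x [r e ux] xv]].
  by exists x => //; exists r.
by exists r => //; apply/IH; exists x.
Qed.

Lemma path_in_det s u x y :
  deterministic G -> path_in G s u x -> path_in G s u y -> x = y.
Proof.
move=> detG; elim: u s => [|a u IH] s /= => [-> -> //|[r e ux] [r' e']].
by rewrite -(detG _ _ _ _ e e'); apply: IH.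
Qed.

Lemma reachable_refl s : reachable G s s.
Proof. by exists [::]. Qed.

Lemma reachable_step s x a y : reachable G s x -> G (x, a, y) -> reachable G s y.
Proof.
move=> [u ux] e; exists (u ++ [:: a]); apply/path_in_cat.
by exists x => //=; exists y.
Qed.

Lemma vertices_src s a t : G (s, a, t) -> vertices G s.
Proof. by move=> e; exists a, t; left. Qed.

Lemma vertices_tgt s a t : G (s, a, t) -> vertices G t.
Proof. by move=> e; exists a, s; right. Qed.

Lemma reachable_vertices s : vertices G s -> reachable G s `<=` vertices G.
Proof.
move=> sG x [u]; elim: u s sG => [|a u IH] s sG /= => [<- //|[r e]].
by apply: IH; apply: vertices_tgt e.
Qed.

Lemma down_edge s x a y :
  reachable G s x -> G (x, a, y) -> Defs.down G s (x, a, y).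
Proof. by move=> sx e; do !split => //=; apply: reachable_step sx e. Qed.

End Paths.

(** * Transport of paths in an arc-symmetric graph *)

Section ArcSymmetric.
Variables (V A : Type) (G : edges V A).
Hypotheses (neG : is_graph G) (asG : arc_symmetric G).

(** The graph has some edge; an isomorphism sending its source to [s] carries it to an edge leaving
    [s]. *)
Lemma arc_symmetric_out s : vertices G s -> exists a t, G (s, a, t).
Proof.
case: neG => -[[p a] q] e sG.
have [f [_ iso] fp] := asG (vertices_src e) sG.
have d := down_edge (reachable_refl G p) e.
have := (iso p a q (vertices_src d) (vertices_tgt d)).1 d.
by rewrite fp => -[e' _]; exists a, (f q).
Qed.

(** An isomorphism is only controlled on the endpoints of edges of [down G s]. As there are no
    sinks, these include every vertex reachable from [s], so injectivity holds there and paths are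
    transported edge by edge. *)
Lemma arc_symmetric_transport s t : vertices G s -> vertices G t ->
  exists f : V -> V,
    [/\ f s = t, {in reachable G s &, injective f} &
        forall u x, path_in G s u x -> path_in G t u (f x)].
Proof.
move=> sG tG; have [f [[_ inj _] iso] fs] := asG sG tG.
have sub x : reachable G s x -> vertices (Defs.down G s) x.
  move=> sx; have [a [y e]] := arc_symmetric_out (reachable_vertices sG sx).
  exact: vertices_src (down_edge sx e).
exists f; split=> // [x y /set_mem sx /set_mem sy|].
  by apply: inj; apply/mem_set/sub.
have edge x a y : reachable G s x -> G (x, a, y) -> G (f x, a, f y).
  move=> sx e; have d := down_edge sx e.
  by have [] := (iso x a y (vertices_src d) (vertices_tgt d)).1 d.
suff h u x y : reachable G s x -> path_in G x u y -> path_in G (f x) u (f y).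
  by move=> u x; rewrite -fs; apply: h; apply: reachable_refl.
elim: u x => [|a u IH] x sx /= => [-> //|[r e ry]].
by exists (f r); [exact: edge | apply: IH ry; apply: reachable_step sx e].
Qed.

End ArcSymmetric.

(** The equality and choice structures come from classical logic; the two equations are all that is
    needed later to compute in the packed monoid. *)
Lemma monoid_of_laws (T : Type) (op : T -> T -> T) (e : T) :
  associative op -> left_id e op -> right_id e op ->
  exists mT : Monoid T, let M : monoidType := Monoid.Pack mT in
    @monoid.mul M = op /\ @monoid.one M = e.
Proof.
move=> opA op1 opr1.
pose C : choiceType := HB.pack T (gen_eqMixin T) (gen_choiceMixin T).
pose M : monoidType := HB.pack (Choice.sort C) (isMonoid.Build C opA op1 opr1).
by exists (Monoid.class M).
Qed.

(** * Cayley graphs of left-cancellative monoids, embedded in [V] by an injection [j] *)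

Section CayleyImage.
Local Open Scope group_scope.
Variables (V A : Type) (M : monoidType) (Q : set M) (lab : Q -> A) (j : M -> V).
Hypotheses (lcM : left_cancellative M) (genQ : generates Q).
Hypotheses (lab_inj : injective lab) (j_inj : injective j).

Let G : edges V A := [set (j e.1.1, e.1.2, j e.2) | e in cayley lab].
Hypothesis neG : is_graph G.

Lemma cayley_imageE s a t :
  G (s, a, t) <-> exists p q, [/\ s = j p, a = lab q & t = j (p * val q)].
Proof.
split=> [[_ [[p q] _ <-] [<- <- <-]]|[p [q [-> -> ->]]]]; first by exists p, q.
by exists (p, lab q, p * val q) => //; exists (p, q).
Qed.

Lemma cayley_image_edge p q : G (j p, lab q, j (p * val q)).
Proof. by apply/cayley_imageE; exists p, q. Qed.

Lemma cayley_image_path s u t :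
  path_in G (j s) u t -> exists x, t = j (s * x).
Proof.
elim: u s => [|a u IH] s /= => [<-|]; first by exists 1; rewrite mulg1.
move=> [_ /cayley_imageE[p [q [/j_inj <- _ ->]]] /IH[x ->]].
by exists (val q * x); rewrite mulgA.
Qed.

Lemma cayley_image_reachable s : reachable G (j s) = range (fun x => j (s * x)).
Proof.
apply/seteqP; split=> [t [u /cayley_image_path[x ->]]|_ [x _ <-]].
  by exists x.
have [l ->] := genQ x; exists (map lab l).
elim: l s => [|q l IH] s /=; first by rewrite big_nil mulg1.
rewrite big_cons mulgA; exists (j (s * val q)) => //.
exact: cayley_image_edge.
Qed.

(** Without a generator no element would be a vertex; nonemptiness of the graph provides one. *)
Lemma cayley_image_gen : inhabited Q.
Proof. by case: neG => -[[s a] t] /cayley_imageE[_ [q _]]. Qed.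

Lemma cayley_image_vertices : vertices G = range j.
Proof.
apply/seteqP; split=> [t [a [s []/cayley_imageE[p [q []]]]]|_ [p _ <-]].
- by move=> -> _ _; exists p.
- by move=> _ _ ->; exists (p * val q).
have [q] := cayley_image_gen; exact: vertices_src (cayley_image_edge p q).
Qed.

(** By associativity, the part reachable from [s] is the left translate by [s] of the whole graph.
    In these coordinates arc-symmetry only has to replace [s] by [t]. *)
Lemma down_cayley_imageE s x a y :
  Defs.down G (j s) (x, a, y) <->
  exists p q, [/\ x = j (s * p), a = lab q & y = j (s * (p * val q))].
Proof.
split.
  move=> [/cayley_imageE[p [q [-> -> ->]]] [/= ]].
  rewrite cayley_image_reachable => -[x' _ /j_inj <-] _.
  by exists x', q; rewrite mulgA.
move=> [p [q [-> -> ->]]]; rewrite mulgA.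
apply: down_edge (cayley_image_edge _ _).
by rewrite cayley_image_reachable; exists p.
Qed.

Lemma down_cayley_image_vertices s :
  vertices (Defs.down G (j s)) = range (fun x => j (s * x)).
Proof.
apply/seteqP; split=> [t|_ [x _ <-]].
  move=> [a [y []/down_cayley_imageE[p [q []]]]].
    by move=> -> _ _; exists p.
  by move=> _ _ ->; exists (p * val q).
have [q] := cayley_image_gen; exists (lab q), (j (s * (x * val q))); left.
by apply/down_cayley_imageE; exists x, q.
Qed.

Lemma cayley_image_rooted : rooted G.
Proof.
exists (j 1); rewrite cayley_image_vertices; first by exists 1.
by rewrite cayley_image_reachable => _ [p _ <-]; exists p; rewrite ?mul1g.
Qed.

Lemma cayley_image_simple : simple G.
Proof.
move=> s t a b /cayley_imageE[p [q [-> -> ->]]].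
by move=> /cayley_imageE[p' [q' [/j_inj <- -> /j_inj/lcM/val_inj <-]]].
Qed.

Lemma cayley_image_deterministic : deterministic G.
Proof.
move=> r s t a /cayley_imageE[p [q [-> -> ->]]].
by move=> /cayley_imageE[p' [q' [/j_inj <- /lab_inj <- ->]]].
Qed.

Lemma cayley_image_arc_symmetric : arc_symmetric G.
Proof.
rewrite /arc_symmetric cayley_image_vertices => _ _ [s _ <-] [t _ <-].
(* The map [s x] to [t x] is well defined because [s] cancels; off the image of [s] the condition is
   vacuous and [v] is a default value. *)
have /choice[f fE] : forall v, exists w, forall x, v = j (s * x) -> w = j (t * x).
  move=> v; have [[x ->]|nx] := pselect (exists x, v = j (s * x)).
    by exists (j (t * x)) => y /j_inj/lcM ->.
  by exists v => x vE; case: nx; exists x.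
have {}fE x : f (j (s * x)) = j (t * x) by exact: fE.
exists f; last by rewrite -[s in LHS]mulg1 fE mulg1.
rewrite /graph_iso !down_cayley_image_vertices; split.
  split=> [_ [x _ <-]|_ _ /set_mem[x _ <-] /set_mem[y _ <-]|_ [x _ <-]].
  - by exists x; rewrite ?fE.
  - by rewrite !fE => /j_inj/lcM ->.
  - by exists (j (s * x)); [exists x | rewrite fE].
move=> _ a _ [x _ <-] [y _ <-]; rewrite !fE !down_cayley_imageE.
by split=> -[p [q [/j_inj/lcM <- -> /j_inj/lcM ->]]]; exists x, q.
Qed.

End CayleyImage.

(** * The monoid of translations of a rooted arc-symmetric graph *)

Section CayleyOfArcSymmetric.
Variables (V A : Type) (G : edges V A).
Hypotheses (neG : is_graph G) (rG : rooted G) (simG : simple G).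
Hypotheses (detG : deterministic G) (asG : arc_symmetric G).

Let X := vertices G.

Lemma arc_symmetric_translations : exists (r : X) (op : X -> X -> X),
  [/\ forall x : X, reachable G (val r) (val x),
      forall s, op s r = s,
      forall s, injective (op s) &
      forall s u (x : X), path_in G (val r) u (val x) ->
        path_in G (val s) u (val (op s x))].
Proof.
case: rG => r rX rall; pose r' : X := exist _ r (mem_set rX).
suff /choice[op opP] : forall s : X, exists f : X -> X,
    [/\ f r' = s, injective f & forall u (x : X),
      path_in G r u (val x) -> path_in G (val s) u (val (f x))].
  exists r', op; split=> [x|s|s|s]; [|by case: (opP s)..].
  exact/rall/set_mem/(valP x).
move=> s; have sX : vertices G (val s) := set_mem (valP s).
have [f [fr finj fP]] := arc_symmetric_transport neG asG rX sX.
have rx (x : X) : reachable G r (val x) by exact/rall/set_mem/(valP x).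
(* The transport [f] maps [X] into itself, since its values are reachable from [s]; [g] is its
   restriction to [X]. *)
have /choice[g gE] : forall x : X, exists y : X, val y = f (val x).
  move=> x; have [u ux] := rx x.
  have yX : X (f (val x)).
    by apply: (reachable_vertices sX); exists u; apply: fP.
  by exists (exist (fun v => v \in X) _ (mem_set yX)).
exists g; split=> [|x y gxy|u x]; last by rewrite gE; apply: fP.
  by apply: val_inj; rewrite gE.
by apply/val_inj/finj; rewrite ?inE -?gE ?gxy //; apply: rx.
Qed.

Lemma arc_symmetric_cayley : is_left_cancellative_monoid_cayley G.
Proof.
have [r [op [rx opr op_inj opP]]] := arc_symmetric_translations.
(* Both [x] and [op r x] end the path from [r] labelled [u]. *)
have opr1 : left_id r op.
  move=> x; have [u ux] := rx x.
  exact/val_inj/(path_in_det detG (opP r u x ux) ux).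
(* Both bracketings end the path from [p] labelled [u ++ v]. *)
have opA : associative op.
  move=> p q x; have [u uq] := rx q; have [v vx] := rx x.
  have uvqx : path_in G (val r) (u ++ v) (val (op q x)).
    by apply/path_in_cat; exists (val q) => //; apply: opP.
  apply/val_inj/(path_in_det detG (opP p _ _ uvqx))/path_in_cat.
  by exists (val (op p q)); apply: opP.
have [mX [mulE oneE]] := monoid_of_laws opA opr1 opr.
exists X, mX => M; split; first by move=> s x y; rewrite mulE; apply: op_inj.
pose Q : set M := [set q : X | exists a, G (val r, a, val q)].
have /choice[lab labP] : forall q : Q, exists a, G (val r, a, val (val q : X)).
  by move=> q; exact: (set_mem (valP q)).
have edgeE (s : X) (q : Q) : G (val s, lab q, val (op s (val q))).
  have [|t e <-] := opP s [:: lab q] (val q); last exact: e.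
  by exists (val (val q : X)).
(* Every edge is a translate of an edge leaving the root: transporting it from [s] back to [r] gives
   a successor [q] of [r]. Simplicity identifies its label with [lab q], and determinism its target
   with [op p q]. *)
have edgeP s a t : G (s, a, t) ->
    exists (p : X) (q : Q), [/\ s = val p, a = lab q & t = val (op p (val q))].
  move=> e; pose p : X := exist _ s (mem_set (vertices_src e)).
  have rX : vertices G (val r) := set_mem (valP r).
  have [f [fs _ fP]] := arc_symmetric_transport neG asG (vertices_src e) rX.
  have [|t' e' fE] := fP [:: a] t; first by exists t.
  rewrite {t'}fE in e'.
  pose q' : X := exist _ (f t) (mem_set (vertices_tgt e')).
  have qQ : Q q' by exists a.
  pose q : Q := exist _ q' (mem_set qQ).
  have aE : a = lab q by exact: simG e' (labP q).
  exists p, q; split=> //; apply: (detG e).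
  by rewrite aE; apply: (edgeE p q).
exists Q, lab; split.
- move=> p; have [u] := rx p.
  (* The edges of a path from [r] to [p] spell a factorization of [p]; the start is generalized to
     [s] for the induction. *)
  suff h (s t : X) : path_in G (val s) u (val t) ->
      exists l : seq Q, t = op s (\big[op/r]_(q <- l) (val q : X)).
    by move=> /h[l ->]; exists l; rewrite opr1 mulE oneE.
  elim: u s t => [|a u IH] s t /=.
    by move=> /val_inj ->; exists [::]; rewrite big_nil opr.
  move=> [_ /edgeP[_ [q [/val_inj <- _ ->]]] /IH[l ->]].
  by exists (q :: l); rewrite big_cons opA.
- move=> q q' qq'; apply/val_inj/val_inj/(detG (labP q)).
  by rewrite qq'; apply: labP.
apply/seteqP; split=> [[[s a] t] /edgeP[p [q [-> -> ->]]]|].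
  exists (p, lab q, op p (val q)) => //.
  by exists (p, q) => //=; rewrite mulE.
by move=> _ [_ [[p q] _ <-] <-] /=; rewrite mulE; apply: edgeE.
Qed.

End CayleyOfArcSymmetric.

Theorem theorem3p6 (V A : Type) (G : edges V A) (hG : is_graph G) :
  is_left_cancellative_monoid_cayley G <->
  rooted G /\ simple G /\ deterministic G /\ arc_symmetric G.
Proof.
split=> [[X [mX [lcM [Q [lab [genQ lab_inj GE]]]]]]|[rG [simG [detG asG]]]].
  rewrite {}GE in hG *; have j_inj := @val_inj _ _ X.
  split; first exact: (cayley_image_rooted genQ j_inj hG).
  split; first exact: (cayley_image_simple lcM j_inj).
  split; first exact: (cayley_image_deterministic lab_inj j_inj).
  exact: (cayley_image_arc_symmetric lcM genQ j_inj hG).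
exact: arc_symmetric_cayley.
Qed.
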